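(* Let $k$ and $n\ge 3$ be odd integers. Then the $k$-coprime graph $\mathrm{CP}(k,n)$ is Hamiltonian.
   Context: For an integer $k$ and a positive integer $n$, $\mathrm{CP}(k,n)$ is the simple graph with vertex set $\{k,k+1,\ldots,k+n-1\}$ in which two distinct vertices $a,b$ are adjacent if and only if $\gcd(a,b)=1$ (with $\gcd(a,0)=|a|$). A graph is Hamiltonian if it contains a cycle through every vertex exactly once. *)

(* Defs.v *)
From HB Require Import structures.
From mathcomp Require Import all_boot all_order all_algebra.

Set Implicit Arguments.
Unset Strict Implicit.
Unset Printing Implicit Defensive.

Import Order.TTheory GRing.Theory Num.Theory.
Local Open Scope ring_scope.

Record sgraph := SGraph {
  svertex : finType;
  adj : rel svertex;
  adj_sym : symmetric adj;
  adj_irrefl : irreflexive adj }.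

(* The bound on the size rules out the closed walks of length at most 2,
   which [cycle] accepts but which are not cycles of a simple graph. *)
Definition hamiltonian (G : sgraph) : Prop :=
  exists c : seq (svertex G),
    [/\ (3 <= size c)%N, cycle (@adj G) c, uniq c & forall x, x \in c].

Definition interval_seq (k : int) (n : nat) : seq int :=
  [seq k + i%:Z | i <- iota 0 n].

Lemma mem_interval_seq (k : int) (n : nat) (x : int) :
  (x \in interval_seq k n) = (k <= x < k + n%:Z).
Proof.
apply/mapP/andP => [[i + ->]|[kx xk]].
  by rewrite mem_iota /= add0n lerDl ltrD2l.
have xk0 : 0 <= x - k by rewrite subr_ge0.
exists (absz (x - k)); last by rewrite gez0_abs // [RHS]addrC subrK.
by rewrite mem_iota /= add0n -ltz_nat gez0_abs // ltrBlDl.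
Qed.

Definition cp_vertex (k : int) (n : nat) : finType := seq_sub (interval_seq k n).

Definition cp_adj (k : int) (n : nat) : rel (cp_vertex k n) :=
  fun a b => (a != b) && (gcdz (val a) (val b) == 1).

Lemma cp_adj_sym (k : int) (n : nat) : symmetric (@cp_adj k n).
Proof. by move=> a b; rewrite /cp_adj eq_sym gcdzC. Qed.

Lemma cp_adj_irrefl (k : int) (n : nat) : irreflexive (@cp_adj k n).
Proof. by move=> a; rewrite /cp_adj eqxx. Qed.

Definition CP (k : int) (n : nat) : sgraph :=
  SGraph (@cp_adj_sym k n) (@cp_adj_irrefl k n).

(* Main.v *)
Require Import Defs.
From HB Require Import structures.
From mathcomp Require Import all_boot all_order all_algebra.
From mathcomp Require Import zify.

(** Write A = k and B = k + n - 1, both odd.  Call t >= A + 2 (t odd) good if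
    the interval [A, t] has a Hamiltonian cycle through the edge {t - 1, t}.
    If t < t' and gcd(t - 1, t') = 1, goodness passes from t to t', by
    replacing {t - 1, t} with the path t, t + 1, ..., t', t - 1.  Steps with
    t' - (t - 1) equal to 3 or 5 show that every t prime to 3 is good.  If
    3 | B, let q be the least odd number > 1 prime to B.  If q = 2 mod 3, then
    B - q + 1 is prime to 3 and steps to B.  If q = 1 mod 3, then B - 2q + 4
    is prime to 3 and steps to B - q + 1, because every prime factor of q - 2
    divides B by minimality of q.  This needs q to be at most about (B - A) / 2.
    When 3 divides both ends, 6 divides B - A, and a prime factor of
    (B - A) / 2 - 1 or (B - A) / 2 - 2 fails to divide B - A, hence fails to
    divide A or B; the reflection x |-> - x exchanges the two ends. *)

Set Implicit Arguments.
Unset Strict Implicit.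
Unset Printing Implicit Defensive.

Import Order.TTheory GRing.Theory Num.Theory.

Lemma coprime_prime_dvd (m d : nat) :
  0 < d -> (forall p, prime p -> p %| m -> p %| d -> False) -> coprime m d.
Proof.
move=> d0 h; have g0 : 0 < gcdn m d by rewrite gcdn_gt0 d0 orbT.
rewrite /coprime eqn_leq g0 andbT leqNgt; apply/negP => g1.
apply: (h _ (pdiv_prime g1)).
- exact: dvdn_trans (pdiv_dvd _) (dvdn_gcdl _ _).
- exact: dvdn_trans (pdiv_dvd _) (dvdn_gcdr _ _).
Qed.

Definition offset_coprime (k : int) : rel nat :=
  fun i j => coprimez (k + i%:Z)%R (k + j%:Z)%R.

Lemma offset_coprime_sym (k : int) : symmetric (offset_coprime k).
Proof. by move=> i j; rewrite /offset_coprime coprimez_sym. Qed.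

(** Since gcd(a, b) = gcd(b, b - a), every later test compares the upper vertex with a distance,
    often just 3 or 5. *)
Lemma offset_coprimeE (k : int) (i j : nat) :
  i <= j -> offset_coprime k i j = coprimez (k + j%:Z)%R (j - i)%N.
Proof.
move=> ij; rewrite offset_coprime_sym -coprimezN /offset_coprime /coprimez.
by rewrite -(gcdzMDl 1 _ (- _)%R) -subzn //; congr (gcdz _ _ == _); lia.
Qed.

Lemma offset_coprime_succ (k : int) (i : nat) : offset_coprime k i i.+1.
Proof. by rewrite offset_coprimeE // subSnn coprimezE coprimen1. Qed.

Lemma path_iota (e : rel nat) (m n : nat) :
  (forall i, e i i.+1) -> path e m (iota m.+1 n).
Proof. by move=> he; elim: n m => //= n IH m; rewrite he IH. Qed.

Lemma last_iota (m n : nat) : last m (iota m.+1 n) = m + n.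
Proof. by elim: n m => [|n IH] m /=; rewrite ?addn0 // IH addSnnS. Qed.

(* Vertices are represented by their offset from k. *)
Definition edge_hamiltonian (k : int) (t : nat) : Prop :=
  exists2 p : seq nat, cycle (offset_coprime k) [:: t.-1, t & p]
                     & perm_eq [:: t.-1, t & p] (iota 0 t.+1).

(** The cycle is the interval in increasing order, closed by the edge {0, t}. *)
Lemma edge_hamiltonian_close (k : int) (t : nat) :
  1 < t -> offset_coprime k 0 t -> edge_hamiltonian k t.
Proof.
case: t => [|[|t]] // _ h; exists (iota 0 t.+1).
  rewrite /= offset_coprime_succ offset_coprime_sym h /= rcons_path.
  rewrite path_iota; last exact: offset_coprime_succ.
  by rewrite last_iota add0n offset_coprime_succ.
have -> : iota 0 t.+3 = iota 0 t.+1 ++ [:: t.+1; t.+2].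
  by rewrite -addn2 iotaD add0n.
by rewrite perm_sym perm_catC.
Qed.

(* Replacing the edge {t-1, t} by the path t, t+1, ..., t'-1, t', t-1. *)
Lemma edge_hamiltonian_step (k : int) (t t' : nat) :
  t.+1 < t' -> offset_coprime k t.-1 t' ->
  edge_hamiltonian k t -> edge_hamiltonian k t'.
Proof.
move=> tt' h [p]; rewrite /= rcons_path => /and3P[_ pp lp] pi.
pose d := t' - t.+2; have t'E : t' = t.+2 + d by rewrite subnKC.
have revp : path (offset_coprime k) t.-1 (rev (t :: p)).
  have := rev_path (offset_coprime k) t (rcons p t.-1).
  rewrite last_rcons belast_rcons => ->.
  rewrite (eq_path (e' := offset_coprime k)); last first.
    by move=> x y; rewrite offset_coprime_sym.
  by rewrite rcons_path pp.
(* The old cycle is run backwards from t - 1 so that it ends at t, where t + 1, ..., t' - 2 is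
   attached; the closing edge leads to t' - 1. *)
exists (t.-1 :: rev (t :: p) ++ iota t.+1 d).
  have t'S : t' = t'.-1.+1 by lia.
  rewrite /= {2}t'S offset_coprime_succ offset_coprime_sym h /=.
  rewrite rcons_path cat_path.
  rewrite revp rev_cons last_cat last_rcons.
  rewrite path_iota; last exact: offset_coprime_succ.
  by rewrite last_iota t'E addSn offset_coprime_succ.
have -> : iota 0 t'.+1 = iota 0 t.+1 ++ iota t.+1 d ++ [:: t'.-1; t'].
  rewrite (_ : t'.+1 = t.+1 + d + 2); last lia.
  by rewrite 2!iotaD add0n catA; congr (_ ++ [:: _; _]); lia.
rewrite -(perm_cat2r (iota t.+1 d ++ [:: t'.-1; t'])) in pi.
rewrite -(permPr pi) perm_sym catA perm_catC !cat_cons cat0s !perm_cons.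
by rewrite -cat_cons perm_cat2r perm_sym perm_rev.
Qed.

Lemma not3_edge_hamiltonian (k : int) (t : nat) :
  ~~ (2 %| k)%Z -> ~~ odd t -> 1 < t -> ~~ (3 %| (k + t%:Z)%R)%Z ->
  edge_hamiltonian k t.
Proof.
move=> hk; elim/ltn_ind: t => t IH ht t1 h3.
have r p i : prime p -> i + p = t -> ~~ (p %| (k + t%:Z)%R)%Z ->
    offset_coprime k i t.
  move=> pp <- hp; rewrite offset_coprimeE ?leq_addr // addKn coprimezE.
  by rewrite coprime_sym prime_coprime.
have base : edge_hamiltonian k 2.
  apply: edge_hamiltonian_close => //; rewrite offset_coprimeE // coprimezE.
  by rewrite coprime_sym prime_coprime //; move: hk; lia.
have [->//|t2] := eqVneq t 2.
have [t4|t4] := eqVneq t 4.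
  by apply: edge_hamiltonian_step base; [lia|apply: (r 3) => //; lia].
(* Starting from t - 2 breaks the edge at t - 3, at distance 3 from t; starting from t - 4 gives
   distance 5. At most one of k + t - 2 and k + t - 4 is a multiple of 3. *)
have [h|h] := boolP (3 %| (k + (t - 2)%N%:Z)%R)%Z; last first.
  apply: (@edge_hamiltonian_step _ (t - 2)); [lia|apply: (r 3) => //; lia|].
  by apply: IH; lia.
have [h5|h5] := boolP (5 %| (k + t%:Z)%R)%Z; last first.
  apply: (@edge_hamiltonian_step _ (t - 4)); [lia|apply: (r 5) => //; lia|].
  by apply: IH; lia.
(* Now 5 divides k + t, hence not k + t - 2, and the route is t - 6, t - 2, t with distances 5 and
   3. For t = 6 there is no room to start, but the ends are coprime. *)
have [t6|t6] := eqVneq t 6.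
  apply: edge_hamiltonian_close => //; rewrite offset_coprimeE // t6 coprimezE.
  rewrite coprime_sym -[6 - 0]/(2 * 3) coprimeMl !prime_coprime //.
  by apply/andP; split; move: hk h3 ht; lia.
apply: (@edge_hamiltonian_step _ (t - 2)); [lia|apply: (r 3) => //; lia|].
apply: (@edge_hamiltonian_step _ (t - 6)); [lia| |apply: IH; lia].
rewrite offset_coprimeE; last lia.
rewrite (_ : t - 2 - (t - 6).-1 = 5); last lia.
by rewrite coprimezE coprime_sym prime_coprime //; move: h5; lia.
Qed.

(** The size condition keeps the starting offset at least 2. With [x] the least admissible value,
    that offset is t - 2x + 4 if x = 1 mod 3 and t - x + 1 if x = 2 mod 3; the alternative
    [q <= 5 < t] forces x = 5, which falls in the second case. *)
Lemma coprime_edge_hamiltonian (k : int) (t q : nat) :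
  ~~ (2 %| k)%Z -> ~~ odd t -> (3 %| (k + t%:Z)%R)%Z ->
  odd q -> 1 < q -> coprimez (k + t%:Z)%R q ->
  (q + q <= t + 2) || (q <= 5 < t) ->
  edge_hamiltonian k t.
Proof.
move=> hk ht h3 oq q1 cq hq.
pose P x := [&& odd x, 1 < x & coprimez (k + t%:Z)%R x].
have exP : exists x, P x by exists q; rewrite /P oq q1.
case: (ex_minnP exP) => x /and3P[ox x1 cx] minx.
have xq : x <= q by apply: minx; rewrite /P oq q1.
have x3 : x %% 3 != 0.
  apply/negP => x3; move: cx; rewrite coprimezE /coprime => /eqP g1.
  by have := dvdn_gcd 3 `|(k + t%:Z)%R| x; rewrite g1; move: h3 x3; lia.
have x5 : 4 < x by move: x3 x1 ox; case: x {cx minx xq} => [|[|[|[|[|x]]]]].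
apply: (@edge_hamiltonian_step _ (t - x).+1); [lia| |].
  by rewrite offset_coprimeE /= ?subKn //; lia.
have [x2|x2] := eqVneq (x %% 3) 2.
  by apply: not3_edge_hamiltonian => //; lia.
apply: (@edge_hamiltonian_step _ (t - x - (x - 4))); [lia| |]; last first.
  by apply: not3_edge_hamiltonian => //; lia.
rewrite offset_coprimeE; last lia.
rewrite (_ : (t - x).+1 - (t - x - (x - 4)).-1 = x - 2); last lia.
rewrite coprimezE; apply: coprime_prime_dvd => [|p pp pa pb]; first lia.
have px : p < x by have := dvdn_leq _ pb; lia.
have op : odd p.
  by apply/negPn/negP => ep; move: pb ox; have := even_prime pp; lia.
have pk : (p %| (k + t%:Z)%R)%Z.
  apply/negPn/negP => npk.
  have : x <= p.
    apply: minx; rewrite /P op prime_gt1 // coprimezE coprime_sym.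
    by rewrite prime_coprime.
  by lia.
(* With B = k + t, p divides B, B - x + 1 and x - 2, hence B - (B - x + 1) - (x - 2) = 1. *)
have p1 : (p %| 1%R)%Z.
  have {}pa : (p %| (k + (t - x).+1%:Z)%R)%Z by [].
  have {}pb : (p %| (x - 2)%N%:Z)%Z by [].
  have := rpredB (rpredB pk pa) pb.
  by rewrite (_ : (_ - _)%R = 1%R) //; lia.
by move: p1 (prime_gt1 pp); rewrite dvdz1; lia.
Qed.

(** Supplies the [a != b] half of [cp_adj], which coprimality alone does not give at the vertices 1
    and -1. *)
Lemma uniq_cycle_neq (T : eqType) (c : seq T) :
  1 < size c -> uniq c -> cycle (fun x y => x != y) c.
Proof.
case: c => [|x [|y s]] // _ uc; rewrite /= rcons_path.
have := uc; rewrite uniq_pairwise => /pairwise_sorted /= /andP[-> hs] /=.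
apply/andP; split; first exact: hs.
by apply: contraTneq uc => xE; rewrite /= -{1}xE mem_last.
Qed.

Definition coprime_hamiltonian (k : int) (n : nat) : Prop :=
  exists2 c : seq int, cycle coprimez c & perm_eq c (interval_seq k n).

Lemma edge_coprime_hamiltonian (k : int) (t : nat) :
  edge_hamiltonian k t -> coprime_hamiltonian k t.+1.
Proof.
case=> p cp pp; exists [seq (k + i%:Z)%R | i <- [:: t.-1, t & p]].
  by rewrite cycle_map.
exact: perm_map.
Qed.

Lemma interval_seq_uniq (k : int) (n : nat) : uniq (interval_seq k n).
Proof. by rewrite map_inj_uniq ?iota_uniq // => i j /addrI[]. Qed.

Lemma coprime_hamiltonian_opp (k : int) (t : nat) :
  coprime_hamiltonian (- (k + t%:Z))%R t.+1 -> coprime_hamiltonian k t.+1.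
Proof.
case=> c cc pc; exists (map -%R%R c).
  rewrite cycle_map (eq_cycle (e' := coprimez)) // => a b /=.
  by rewrite coprimezN coprimeNz.
apply: uniq_perm; rewrite ?interval_seq_uniq //.
  rewrite map_inj_uniq; last exact: oppr_inj.
  by rewrite (perm_uniq pc) interval_seq_uniq.
move=> x; rewrite -[x]opprK mem_map; last exact: oppr_inj.
by rewrite (perm_mem pc) !mem_interval_seq; lia.
Qed.

Lemma hamiltonian_CP (k : int) (n : nat) :
  2 < n -> coprime_hamiltonian k n -> hamiltonian (CP k n).
Proof.
move=> n2 [c cc pc]; have sc := perm_size pc.
rewrite size_map size_iota in sc.
pose c' : seq (cp_vertex k n) := pmap insub c.
have vc' : map val c' = c.
  rewrite pmap_filter; last exact: insubK.
  apply/all_filterP/allP => x; rewrite (perm_mem pc) => xc.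
  by rewrite isSome_insub.
have uc' : uniq c'.
  by apply: (@map_uniq _ _ val); rewrite vc' (perm_uniq pc) interval_seq_uniq.
exists c'; split => //.
- by rewrite -(size_map val) vc' sc.
- rewrite /adj /= /cp_adj cycle_relI uniq_cycle_neq //=; last first.
    by rewrite -(size_map val) vc' sc ltnW.
  by move: cc; rewrite -vc' cycle_map.
- move=> x; rewrite -(mem_map val_inj) vc' (perm_mem pc); exact: valP.
Qed.

Lemma coprime_hamiltonian_end (k : int) (t q : nat) :
  ~~ (2 %| k)%Z -> ~~ odd t -> 1 < t ->
  ~~ (3 %| (k + t%:Z)%R)%Z \/
    [/\ odd q, 1 < q, coprimez (k + t%:Z)%R q &
      (q + q <= t + 2) || (q <= 5 < t)] ->
  coprime_hamiltonian k t.+1.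
Proof.
move=> hk ht t1 h; apply: edge_coprime_hamiltonian.
have [h3|h3] := boolP (3 %| (k + t%:Z)%R)%Z; last exact: not3_edge_hamiltonian.
by case: h => [|[]]; [rewrite h3 | apply: coprime_edge_hamiltonian].
Qed.

(* For t = 2m, a prime factor of m - 1 or m - 2, whichever is odd. *)
Lemma small_prime_ndvd (t : nat) :
  6 %| t -> 0 < t ->
  exists q, [/\ prime q, odd q, ~~ (q %| t) & (q + q <= t + 2) || (q <= 5 < t)].
Proof.
move=> t6 t0; have [->|tn6] := eqVneq t 6; first by exists 5.
pose c := if odd t./2 then t./2 - 2 else t./2 - 1.
have c1 : 1 < c by rewrite /c; case: ifP; lia.
have oc : odd c by rewrite /c; case: ifP; lia.
have pc := pdiv_dvd c; have pp := pdiv_prime c1.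
have oq : odd (pdiv c) by apply: dvdn_odd pc oc.
have qc : pdiv c <= c by apply: dvdn_leq => //; lia.
exists (pdiv c); split => //; last by move: qc; rewrite /c; case: ifP; lia.
apply/negP => pt.
have : pdiv c %| t - (c + c) by rewrite dvdn_sub // dvdn_add.
have : t - (c + c) = 2 \/ t - (c + c) = 4 by rewrite /c; case: ifP; lia.
have cop n : coprime (pdiv c) (2 ^ n) by rewrite coprimeXr // coprimen2.
move: (prime_gt1 pp) => p1 [] -> d.
- by move: (cop 1); rewrite /coprime (gcdn_idPl d); lia.
- by move: (cop 2); rewrite /coprime (gcdn_idPl d); lia.
Qed.

Theorem theorem2p3 (k : int) (n : nat) (hk : ~~ (2 %| k)%Z)
    (hn : (3 <= n)%N) (hodd : odd n) : hamiltonian (CP k n).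
Proof.
apply: hamiltonian_CP => //; case: n hn hodd => // t t1 /= ht.
pose k' := (- (k + t%:Z))%R.
have k'E : (k' + t%:Z = - k)%R by rewrite /k'; lia.
have hk' : ~~ (2 %| k')%Z by move: hk ht; rewrite /k'; lia.
have [h3|h3] := boolP (3 %| (k + t%:Z)%R)%Z; last first.
  by apply: (@coprime_hamiltonian_end _ _ 0) => //; left.
have [h3'|h3'] := boolP (3 %| k)%Z; last first.
  apply: coprime_hamiltonian_opp; apply: (@coprime_hamiltonian_end _ _ 0) => //.
  by left; rewrite k'E; move: h3'; lia.
have t6 : 6 %| t by move: h3 h3' ht; lia.
have [q [pq oq qt hq]] := small_prime_ndvd t6 (ltnW t1).
have [qk|qk] := boolP (q %| k)%Z; last first.
  apply: coprime_hamiltonian_opp; apply: (@coprime_hamiltonian_end _ _ q) => //.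
  right; split; rewrite ?prime_gt1 //.
  by rewrite k'E coprimezE abszN coprime_sym prime_coprime.
apply: (@coprime_hamiltonian_end _ _ q) => //.
right; split; rewrite ?prime_gt1 //.
rewrite coprimezE coprime_sym prime_coprime //.
apply: contra qt => qkt.
have : (q %| (k + t%:Z - k)%R)%Z by rewrite rpredB.
by rewrite addrC addKr.
Qed.
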